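(* Every finite group $G$ with $\alpha(G)=\alpha(Z(G))$ is $4$-abelian. Moreover, if $G$ is a finite group with $\alpha(G)=\alpha(Z(G))$ and $|G|$ is odd, then $G$ is abelian.
   Context: For a finite group $H$, $C(H)$ denotes the set of cyclic subgroups of $H$ and $\alpha(H)=\frac{|C(H)|}{|H|}$. $Z(G)$ denotes the center of $G$. For a positive integer $n$, a group $G$ is called $n$-abelian if $(xy)^n=x^ny^n$ for all $x,y\in G$. *)

(* Defs.v *)
From mathcomp Require Import all_boot all_order all_fingroup all_algebra all_solvable.

Set Implicit Arguments.
Unset Strict Implicit.
Unset Printing Implicit Defensive.

Local Open Scope group_scope.

Definition cyclic_subgroups (gT : finGroupType) (H : {group gT}) :
    {set {group gT}} :=
  [set K in subgroups H | cyclic K].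

Definition alpha (gT : finGroupType) (H : {group gT}) : rat :=
  (#|cyclic_subgroups H|%:R / #|H|%:R)%R.

Definition n_abelian (gT : finGroupType) (n : nat) (G : {group gT}) : Prop :=
  {in G &, forall x y, (x * y) ^+ n = x ^+ n * y ^+ n}.

(* Main.v *)
Require Import Defs.
From mathcomp Require Import all_boot all_order all_fingroup all_algebra all_solvable.
Set Implicit Arguments.
Unset Strict Implicit.
Unset Printing Implicit Defensive.
Import GroupScope Order.TTheory GRing.Theory Num.Theory.

(** A cyclic group of order n has totient n generators, so giving each x in G
    the weight 1 / totient #[x] makes every cyclic subgroup count once:
    alpha G is the average weight of the elements of G
    ([card_cyclic_subgroups]).  The theorem then follows from a comparison of
    each coset x Z of a central subgroup Z with Z itself.

    Let y be an element of least order in x Z.  For z in Z, another element of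
    the coset has order dividing the gcd of #[y] and #[y * z]
    ([exists_order_dvdn_gcd]): take, prime by prime, the better of the two
    primary components.  Minimality forces #[y] to divide #[y * z], and then
    #[z] divides #[y * z] as well ([exists_coset_order_dvdn]).  Since totient
    is monotone for divisibility ([leq_totient]), y * z weighs at most as much
    as z, term by term; so x Z weighs at most as much as Z, and equality
    forces y, the term z = 1, to have weight 1, that is y ^+ 2 = 1, whence
    x ^+ 2 is in Z ([sum_weight_coset]).

    If alpha G = alpha Z, the average over the cosets leaves no slack, so all
    squares of G lie in Z ([alpha_eq_central_sqr]).  With Z = 'Z(G), a group of
    odd order consists of squares and is therefore central in itself.  In
    general, commutators are products of squares, hence central, so
    [~ y, x] ^+ 2 = [~ y ^+ 2, x] = 1, and the correction factor
    [~ y, x] ^+ 6 in the expansion of (x * y) ^+ 4 disappears. *)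

(** * Totients and parts of divisors *)

Lemma leq_totient_mul_prime p m :
  prime p -> 0 < m -> totient m <= totient (p * m).
Proof.
move=> p_pr m_gt0; have p_gt0 := prime_gt0 p_pr.
have [e [m' [p'm' Em]]] : exists e m', coprime p m' /\ m = (p ^ e * m')%N.
  exists (logn p m), (m`_p^')%N; rewrite -p_part partnC //; split=> //.
  by rewrite prime_coprime // -p'natE // part_pnat.
rewrite {}Em in m_gt0 *; rewrite mulnA -expnS !totient_coprime ?coprimeXl //.
rewrite leq_mul2r (@totient_pfactor _ e.+1) //; apply/orP; right.
case: e m_gt0 => [|e] _.
  by rewrite expn0 muln1 -subn1 subn_gt0 prime_gt1.
by rewrite totient_pfactor // leq_mul2l /= leq_pexp2l ?orbT.
Qed.

(** Removing one prime factor at a time from n / d reduces to the previous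
    lemma. *)
Lemma leq_totient d n : 0 < n -> d %| n -> totient d <= totient n.
Proof.
move=> n_gt0 /dvdnP[k En]; rewrite {}En muln_gt0 in n_gt0 *.
have [k_gt0 d_gt0] := andP n_gt0; move: d d_gt0 {n_gt0}.
have [m] := ubnP k; elim: m k k_gt0 => // m IHm k k_gt0 le_km d d_gt0.
have [k_le1 | k_gt1] := leqP k 1.
  by rewrite (_ : k = 1%N) ?mul1n //; apply/eqP; rewrite eqn_leq k_le1.
have p_pr := pdiv_prime k_gt1.
have [q Ek] := dvdnP (pdiv_dvd k).
have q_gt0 : 0 < q by case: q Ek k_gt0 => // ->.
have lt_qk : q < k by rewrite Ek ltn_Pmulr // prime_gt1.
apply: leq_trans (IHm q q_gt0 (leq_trans lt_qk le_km) d d_gt0) _.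
rewrite Ek mulnAC [(q * d * _)%N]mulnC.
by rewrite leq_totient_mul_prime ?muln_gt0 ?q_gt0.
Qed.

Lemma dvdn_partn_log (pi : nat_pred) m n :
    0 < m -> 0 < n -> {in pi, forall p, logn p m <= logn p n} ->
  (m`_pi %| n`_pi)%N.
Proof.
move=> m_gt0 n_gt0 le_mn; apply/dvdn_partP => // p.
rewrite pi_of_part // => /andP[_ pi_p].
have sub_p : {subset (p : nat_pred) <= pi} by move=> q /eqP->.
apply: dvdn_trans (dvdn_part p _).
by rewrite !partn_part // !p_part dvdn_exp2l ?le_mn.
Qed.

(** * Orders in a coset *)

(** Let pi be the primes at which #[x * z] has the smaller valuation.
    Multiplying x by the pi-part of z yields the element whose pi-part is that
    of x * z and whose pi'-part is that of x, so that its order has the smaller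
    of the two valuations at each prime. *)
Lemma exists_order_dvdn_gcd (gT : finGroupType) (x z : gT) : commute x z ->
  exists2 w, w \in <[z]> & #[x * w] %| gcdn #[x] #[x * z].
Proof.
move=> cxz; pose pi : nat_pred := [pred p | logn p #[x * z] < logn p #[x]].
exists z.`_pi; first exact: groupX (cycle_id z).
have cxw : commute x z.`_pi by apply: commuteX.
have Epi : (x * z.`_pi).`_pi = (x * z).`_pi.
  by rewrite !consttM // [z.`_pi.`_pi]constt_p_elt ?p_elt_constt.
have Epi' : (x * z.`_pi).`_pi^' = x.`_pi^'.
  rewrite consttM // [z.`_pi.`_pi^'](_ : _ = 1) ?mulg1 //.
  by apply/constt1P; rewrite p_eltNK p_elt_constt.
rewrite -(partnC pi (order_gt0 _)) -!order_constt {}Epi {}Epi' !order_constt.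
rewrite -(@partnC pi (gcdn _ _)) ?gcdn_gt0 ?order_gt0 //.
rewrite !partn_gcd ?order_gt0 // dvdn_mul // dvdn_gcd dvdnn ?andbT /=.
  by apply: dvdn_partn_log; rewrite ?order_gt0 // => p /ltnW.
by apply: dvdn_partn_log; rewrite ?order_gt0 // => p; rewrite !inE -leqNgt.
Qed.

(** The translate x * w is chosen of least order in the coset of x: this is
    the representative around which the coset looks like a copy of Z with
    larger orders. *)
Lemma exists_coset_order_dvdn (gT : finGroupType) (x : gT) (Z : {group gT}) :
    abelian Z -> x \in 'C(Z) ->
  exists2 w, w \in Z & {in Z, forall z, #[z] %| #[x * w * z]}.
Proof.
move=> abZ cxZ.
case: (arg_minnP (fun w => #[x * w]) (group1 Z)) => w Zw min_w.
exists w => // z Zz; set y := x * w.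
have cyz : commute y z.
  by apply: (centP _ z Zz); rewrite groupM // (subsetP abZ).
have [v v_z dvd_v] := exists_order_dvdn_gcd cyz.
have Zv : v \in Z by apply: subsetP v_z; rewrite cycle_subG.
have dvd_y : #[y] %| #[y * z].
  have le_y : #[y] <= gcdn #[y] #[y * z].
    have g_gt0 : 0 < gcdn #[y] #[y * z] by rewrite gcdn_gt0 order_gt0.
    apply: leq_trans (dvdn_leq g_gt0 dvd_v).
    by rewrite -mulgA; apply: min_w (groupM Zw Zv).
  move: le_y (order_gt0 y); move: #[y] #[y * z] => d n le_d d_gt0.
  by apply/gcdn_idPl/eqP; rewrite eqn_leq le_d andbT dvdn_leq ?dvdn_gcdl.
(* The order of y * z kills both y * z and y, hence also z. *)
rewrite order_dvdn; apply/eqP; apply: (mulgI (y ^+ #[y * z])).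
by rewrite -expgMn // expg_order (eqP _ : y ^+ _ = 1) ?mulg1 // -order_dvdn.
Qed.

(** * Counting cyclic subgroups by weighted elements *)

Local Notation weight x := ((totient #[x])%:R^-1 : rat)%R.

(** The elements are grouped by the cyclic subgroup that they generate; the
    totient #[a] generators of <[a]> have total weight 1. *)
Lemma card_cyclic_subgroups (gT : finGroupType) (G : {group gT}) :
  (#|cyclic_subgroups G|%:R = \sum_(x in G) weight x)%R.
Proof.
rewrite (partition_big (fun x => <[x]>%G) (mem (cyclic_subgroups G))) /=;
  last first.
  by move=> x Gx; rewrite !inE cycle_subG Gx cycle_cyclic.
rewrite -sum1_card natr_sum; apply: eq_bigr => K.
rewrite !inE => /andP[sKG /cyclicP[a Ka]].
have -> : (\sum_(x in G | <[x]>%G == K) weight x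
          = \sum_(x in [set x | generator <[a]> x]) weight a)%R.
  apply: eq_big => [x | x /andP[_ /eqP Ex]].
    rewrite inE /generator -Ka -val_eqE /= [K == _ :> {set _}]eq_sym.
    rewrite andb_idl //.
    by move/eqP=> Ex; rewrite -cycle_subG Ex.
  by rewrite /order -Ka -Ex.
rewrite sumr_const -totient_gen -[LHS]/1%R -[RHS]mulr_natr mulVf //.
by rewrite pnatr_eq0 -lt0n totient_gt0 order_gt0.
Qed.

(** After translation by the representative x * w of least order, the
    inequality holds term by term; in the equality case the term at z = 1 says
    that totient #[x * w] = 1, so that x * w has order 1 or 2. *)
Lemma sum_weight_coset (gT : finGroupType) (x : gT) (Z : {group gT}) :
    abelian Z -> x \in 'C(Z) ->
  (\sum_(z in Z) weight (x * z) <= \sum_(z in Z) weight z)%R /\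
  ((\sum_(z in Z) weight (x * z) = \sum_(z in Z) weight z)%R -> x ^+ 2 \in Z).
Proof.
move=> abZ cxZ; have [w Zw dvd_w] := exists_coset_order_dvdn abZ cxZ.
have -> : (\sum_(z in Z) weight (x * z) = \sum_(z in Z) weight (x * w * z))%R.
  rewrite (reindex_inj (mulgI w)) /=.
  by apply: eq_big => z; rewrite ?groupMl ?mulgA.
have le_w z : z \in Z -> (weight (x * w * z) <= weight z)%R.
  move=> Zz; rewrite lef_pV2 ?posrE ?ltr0n ?totient_gt0 ?order_gt0 // ler_nat.
  by rewrite leq_totient ?order_gt0 ?dvd_w.
split=> [|/esym/eqP]; first exact: ler_sum.
rewrite -subr_eq0 -sumrB => /eqP/psumr_eq0P.
move/(_ _ 1 (group1 Z)) => /=; rewrite mulg1 order1 => E.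
have {E} E : weight (x * w) = 1%R.
  apply/esym/subr0_eq; rewrite -[RHS]E ?invr1 // => z Zz.
  by rewrite subr_ge0 le_w.
have {E} E : totient #[x * w] = 1%N.
  by apply/eqP; rewrite -(eqr_nat rat) -invr_eq1 E.
have le2 : #[x * w] <= 2 by rewrite leqNgt -totient_gt1 E.
have xw2 : (x * w) ^+ 2 = 1.
  apply/eqP; rewrite -order_dvdn.
  by case: #[_] (order_gt0 (x * w)) le2 => [|[|[|]]].
have cxw : commute x w by apply: (centP cxZ).
rewrite expgMn // in xw2.
have -> : x ^+ 2 = (w ^+ 2)^-1 by apply/eqP; rewrite eq_mulgV1 invgK xw2.
by rewrite groupV groupX.
Qed.

(** Averaging over translates by Z, instead of choosing coset representatives,
    writes |Z| times the total weight of G as the sum over x in G of the weight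
    of x Z.  Each term is at most the weight of Z, and the hypothesis says that
    they reach this bound on average. *)
Lemma alpha_eq_central_sqr (gT : finGroupType) (G Z : {group gT}) :
  Z \subset 'Z(G) -> alpha G = alpha Z -> {in G, forall x, x ^+ 2 \in Z}.
Proof.
rewrite subsetI => /andP[sZG cGZ] alphaGZ.
have abZ : abelian Z := centsS sZG cGZ.
have cZ x : x \in G -> x \in 'C(Z) by apply: subsetP x; rewrite centsC.
have nz (H : {group gT}) : (#|H|%:R != 0 :> rat)%R.
  by rewrite pnatr_eq0 -lt0n cardG_gt0.
pose S (x : gT) := (\sum_(z in Z) weight (x * z))%R.
have sumS : (\sum_(x in G) S x = #|Z|%:R * #|cyclic_subgroups G|%:R)%R.
  rewrite exchange_big /=.
  rewrite (eq_bigr (fun=> #|cyclic_subgroups G|%:R)%R) => [|z Zz].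
    by rewrite sumr_const mulr_natl.
  rewrite card_cyclic_subgroups [RHS](reindex_inj (mulIg z)) /=.
  by apply: eq_bigl => x; rewrite groupMr // (subsetP sZG).
have sum0 : (\sum_(x in G) (\sum_(z in Z) weight z - S x) = 0)%R.
  rewrite sumrB sumS sumr_const -card_cyclic_subgroups.
  have /eqP := alphaGZ; rewrite /alpha eqr_div // => /eqP alphaGZ'.
  by rewrite -[(_ *+ #|G|)%R]mulr_natr -alphaGZ' mulrC subrr.
move=> x Gx; apply: (sum_weight_coset abZ (cZ x Gx)).2.
apply/esym/subr0_eq; apply: (psumr_eq0P _ sum0) => // y Gy.
by rewrite subr_ge0 (sum_weight_coset abZ (cZ y Gy)).1.
Qed.

Theorem corollary3 (gT : finGroupType) (G : {group gT})
    (hG : alpha G = alpha 'Z(G)%G) :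
  n_abelian 4 G /\ (odd #|G| -> abelian G).
Proof.
have sqrZ := alpha_eq_central_sqr (subxx _) hG.
split=> [x y Gx Gy | oddG]; last first.
  apply/centsP=> x Gx y Gy.
  (* Squaring is a bijection of G, so x is a power of x ^+ 2. *)
  have coG2 : coprime #|G| 2 by rewrite coprimen2.
  have : x \in 'Z(G) by rewrite -(expgK coG2 Gx) groupX ?sqrZ.
  by case/centerP=> _; apply.
have cR g h k : g \in G -> h \in G -> k \in G -> commute k [~ g, h].
  move=> Gg Gh Gk; suffices /centerP[_ cgh] : [~ g, h] \in 'Z(G).
    exact/commute_sym/cgh.
  have -> : [~ g, h] = (g^-1) ^+ 2 * ((g * h^-1) ^+ 2 * h ^+ 2).
    by rewrite !expgS !expg0 !mulg1 commgEl conjgE !mulgA !mulgKV.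
  by apply: groupM; last apply: groupM; apply: sqrZ; rewrite ?groupM ?groupV.
rewrite expMg_Rmul; [|exact: cR..].
rewrite (_ : binomial 4 2 = 2 * 3)%N // expgM -commXg; last exact: cR.
have /centerP[_ /(_ _ Gx)/commgP/eqP->] := sqrZ _ Gy.
by rewrite expg1n mulg1.
Qed.
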